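(* Let $A_q$ be a quantum cluster algebra with quantum seed $(\tilde X,\tilde B,\Lambda)$ and let $\{-,-\}$ be a Poisson structure on $A_q$ such that $\tilde X$ is log-canonical with respect to it, $\{X_i,X_j\}=\omega_{ij}X^{e_i+e_j}$ for all $i,j\in[1,m]$. Let $k\in[1,n]$. Then $\mu_k(\tilde X)$ is log-canonical with respect to $\{-,-\}$ if and only if for every $j\in[1,m]$ with $j\neq k$ the following three conditions hold: (i) for every $u\in[1,m]$ with $b_{uk}\neq0$: $\ \omega_{uj}\,(q^{\frac12\lambda_{kj}}-q^{\frac12\lambda_{jk}})=\omega_{kj}\,(q^{\frac12\lambda_{uj}}-q^{\frac12\lambda_{ju}})$; (ii) for all $u,v\in[1,m]$ with $b_{uk}b_{vk}\neq0$: $\ \omega_{uj}\,(q^{\frac12\lambda_{vj}}-q^{\frac12\lambda_{jv}})=\omega_{vj}\,(q^{\frac12\lambda_{uj}}-q^{\frac12\lambda_{ju}})$; (iii) $\displaystyle\sum_{t\in[1,m]:\,\lambda_{tj}=0}\omega_{tj}b_{tk}=0$.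
   Context: Notation: $[1,m]=\{1,\dots,m\}$; $[a]_+=\max\{a,0\}$, applied componentwise to vectors. Fix $n\le m$. Quantum cluster algebras. $\tilde B=(b_{ij})$ is an $m\times n$ integer matrix whose top $n\times n$ part $B$ is skew-symmetrizable: there is a positive diagonal matrix $D$ (a skew-symmetrizer) with $DB$ skew-symmetric. $\Lambda=(\lambda_{ij})$ is a skew-symmetric $m\times m$ integer matrix such that $(\tilde B,\Lambda)$ is a compatible pair: $\tilde B^\top\Lambda=(D\ \ O)$. Let $q$ be a formal variable. The quantum torus is the $\mathbb Z[q^{\pm 1/2}]$-algebra with basis $X^e$ ($e\in\mathbb Z^m$) and product $X^eX^f=q^{\frac12 e^\top\Lambda f}X^{e+f}$; $\mathscr F_q$ is its skew-field of fractions; $X_i=X^{e_i}$ with $e_i$ the standard basis. A quantum seed is $(\tilde X,\tilde B,\Lambda)$ with extended cluster $\tilde X=(X_1,\dots,X_m)$; $X_1,\dots,X_n$ are cluster variables and $X_{n+1},\dots,X_m$ are frozen. For $k\in[1,n]$ the mutation $\mu_k$ replaces $X_k$ by $X_k'=X^{-e_k+[b_k]_+}+X^{-e_k+[-b_k]_+}$ ($b_k$ the $k$-th column of $\tilde B$), replaces $\tilde B$ by $\tilde B'$ with $b'_{ij}=-b_{ij}$ if $i=k$ or $j=k$ and $b'_{ij}=b_{ij}+\mathrm{sgn}(b_{ik})[b_{ik}b_{kj}]_+$ otherwise, and replaces $\Lambda$ by the skew-symmetric $\Lambda'$ with $\lambda'_{kj}=-\lambda_{kj}+\sum_{l=1}^m[b_{lk}]_+\lambda_{lj}$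 for $j\ne k$ and $\lambda'_{ij}=\lambda_{ij}$ for $i,j\neq k$. The result is again a quantum seed, whose normalized monomials $X'^e$ satisfy the same relation with $\Lambda'$. $A_q$ is the $\mathbb Z[q^{\pm1/2}][X_{n+1}^{\pm1},\dots,X_m^{\pm1}]$-subalgebra of $\mathscr F_q$ generated by all cluster variables of all seeds obtained by iterated mutation. Poisson structures. A Poisson structure on an associative algebra over $k=\mathbb Z[q^{\pm1/2}]$ is a $k$-bilinear Lie bracket with $\{a,bc\}=\{a,b\}c+b\{a,c\}$ (the algebra need not be commutative); it is extended to fractions by the Leibniz rule. An extended cluster $\tilde X$ is log-canonical with respect to $\{-,-\}$ if $\{X_i,X_j\}=\omega_{ij}X^{e_i+e_j}$ with $\omega_{ij}\in\mathbb Z[q^{\pm1/2}]$ for all $i,j\in[1,m]$. *)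

(* Defs.v *)
From HB Require Import structures.
From mathcomp Require Import all_boot all_order all_algebra.
From mathcomp Require Import boolp.

Set Implicit Arguments.
Unset Strict Implicit.
Unset Printing Implicit Defensive.

Import Order.TTheory GRing.Theory Num.Theory.
Local Open Scope ring_scope.
Local Notation "x %:F" := (tofrac x) : ring_scope.

(* The ground ring Z[q^(1/2), q^(-1/2)] is realised as the subring of the field
   Frac(Z[v]), v = q^(1/2), formed by the elements p / v^N with p in Z[v]. *)
Definition qhalf_frac : {fraction {poly int}} := 'X%:F.

Definition laurent_pred : {pred {fraction {poly int}}} :=
  fun x => `[< exists (p : {poly int}) (N : nat), x = p%:F / qhalf_frac ^+ N >].

Fact qhalf_frac_neq0 : qhalf_frac != 0.
Proof. by rewrite /qhalf_frac tofrac_eq0 polyX_eq0. Qed.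

Fact laurent_subring : subring_closed laurent_pred.
Proof.
have v0 N : qhalf_frac ^+ N != 0 by rewrite expf_neq0 ?qhalf_frac_neq0.
split.
- by apply/asboolP; exists 1, 0; rewrite expr0 divr1 tofrac1.
- move=> x y /asboolP[p [N ->]] /asboolP[r [M ->]]; apply/asboolP.
  exists (p * 'X^M - r * 'X^N), (N + M)%N.
  rewrite tofracB !tofracM !tofracXn -mulNr (addf_div _ _ (v0 N) (v0 M)).
  by rewrite -mulNr -exprD.
- move=> x y /asboolP[p [N ->]] /asboolP[r [M ->]]; apply/asboolP.
  by exists (p * r), (N + M)%N; rewrite tofracM mulf_div -exprD.
Qed.

HB.instance Definition _ :=
  GRing.isSubringClosed.Build {fraction {poly int}} laurent_pred laurent_subring.

Record laurent := Laurent { laurent_val :> {fraction {poly int}};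
                            _ : laurent_val \in laurent_pred }.
HB.instance Definition _ := [isSub for laurent_val].
HB.instance Definition _ := [Choice of laurent by <:].
HB.instance Definition _ := [SubChoice_isSubComNzRing of laurent by <:].

Fact qhalf_pow_subproof (z : int) : qhalf_frac ^ z \in laurent_pred.
Proof.
apply/asboolP; case: z => N.
  by exists 'X^N, 0; rewrite expr0 divr1 tofracXn.
by exists 1, N.+1; rewrite tofrac1 div1r NegzE.
Qed.

(* q^(z/2) *)
Definition qhalf (z : int) : laurent := Laurent (qhalf_pow_subproof z).

Definition pos_part (a : int) : int := Num.max a 0.

Definition evec (m : nat) (i : 'I_m) : 'rV[int]_m := delta_mx 0 i.

Definition top_part (m n : nat) (hnm : (n <= m)%N) (Bt : 'M[int]_(m, n)) :
  'M[int]_n := \matrix_(i, j) Bt (widen_ord hnm i) j.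

Definition skew_symmetric (n : nat) (A : 'M[int]_n) : Prop := A^T = - A.

Definition skew_symmetrizer (n : nat) (d : 'rV[int]_n) (B : 'M[int]_n) : Prop :=
  (forall i, 0 < d 0 i) /\ skew_symmetric (diag_mx d *m B).

Definition compatible_pair (m n : nat) (hnm : (n <= m)%N)
    (Bt : 'M[int]_(m, n)) (Lam : 'M[int]_m) : Prop :=
  skew_symmetric Lam /\
  exists2 d : 'rV[int]_n, skew_symmetrizer d (top_part hnm Bt)
    & Bt^T *m Lam =
      \matrix_(i < n, j < m) (if widen_ord hnm i == j then d 0 i else 0).

Definition torus_elt (m : nat) (F : unitAlgType laurent)
    (T : 'rV[int]_m -> F) (x : F) : Prop :=
  exists (s : seq 'rV[int]_m) (c : 'rV[int]_m -> laurent),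
    x = \sum_(e <- s) c e *: T e.

(* F is a skew field of fractions of the quantum torus of Lam, whose basis
   element X^e is T e; this determines (F, T) up to unique isomorphism. *)
Record torus_fractions (m : nat) (Lam : 'M[int]_m) (F : unitAlgType laurent)
    (T : 'rV[int]_m -> F) : Prop := TorusFractions {
  torus_mul : forall e f : 'rV[int]_m,
    T e * T f = qhalf ((e *m Lam *m f^T) 0 0) *: T (e + f);
  torus_free : forall (s : seq 'rV[int]_m) (c : 'rV[int]_m -> laurent),
    uniq s -> \sum_(e <- s) c e *: T e = 0 -> forall e, e \in s -> c e = 0;
  fractions_division : forall x : F, x != 0 -> x \is a GRing.unit;
  fractions_torus : forall x : F, exists a b : F,
    [/\ torus_elt T a, torus_elt T b, b != 0 & x = a * b^-1] }.

Record seed (m n : nat) (F : unitAlgType laurent) := Seed {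
  cluster : 'I_m -> F;
  exch : 'M[int]_(m, n);
  form : 'M[int]_m }.

(* The normalized monomial X^e of an extended cluster Y with q-commutation
   matrix Lam, expressed through the ordered product of the powers of the Y_i:
   iterating X^e X^f = q^(e^T Lam f / 2) X^(e+f) gives
   Y_1^(e_1) ... Y_m^(e_m) = q^(sum_(i<j) Lam_ij e_i e_j / 2) X^e. *)
Definition nmonomial (m : nat) (F : unitAlgType laurent) (Lam : 'M[int]_m)
    (Y : 'I_m -> F) (e : 'rV[int]_m) : F :=
  qhalf (- \sum_(i < m) \sum_(j < m | (i < j)%N) Lam i j * e 0 i * e 0 j)
    *: \prod_(i < m) Y i ^ e 0 i.

Definition smonomial (m n : nat) (F : unitAlgType laurent) (S : seed m n F) :
  'rV[int]_m -> F := nmonomial (form S) (cluster S).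

Section Mutation.
Context (m n : nat) (hnm : (n <= m)%N) (F : unitAlgType laurent).
Implicit Types (S : seed m n F) (k : 'I_n).

Definition mut_cluster S k (i : 'I_m) : F :=
  let kk := widen_ord hnm k in
  let b := fun l => exch S l k in
  if i == kk then
    smonomial S (- evec kk + \row_l pos_part (b l))
    + smonomial S (- evec kk + \row_l pos_part (- b l))
  else cluster S i.

Definition mut_exch S k : 'M[int]_(m, n) :=
  let kk := widen_ord hnm k in
  let b := exch S in
  \matrix_(i, j) if (i == kk) || (j == k) then - b i j
                 else b i j + Num.sg (b i k) * pos_part (b i k * b kk j).

Definition mut_form S k : 'M[int]_m :=
  let kk := widen_ord hnm k in
  let row j := - form S kk j + \sum_l pos_part (exch S l k) * form S l j in
  \matrix_(i, j) if i == kk then (if j == kk then 0 else row j)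
                 else if j == kk then - row i else form S i j.

Definition mutation k S : seed m n F :=
  Seed (mut_cluster S k) (mut_exch S k) (mut_form S k).

Inductive mutation_equiv (S0 : seed m n F) : seed m n F -> Prop :=
| mutation_refl : mutation_equiv S0 S0
| mutation_step S k : mutation_equiv S0 S -> mutation_equiv S0 (mutation k S).

End Mutation.

Inductive gen_subalg (F : unitAlgType laurent) (G : F -> Prop) : F -> Prop :=
| gen_in x : G x -> gen_subalg G x
| gen_scalar (a : laurent) : gen_subalg G a%:A
| gen_add x y : gen_subalg G x -> gen_subalg G y -> gen_subalg G (x + y)
| gen_mul x y : gen_subalg G x -> gen_subalg G y -> gen_subalg G (x * y).

Inductive cluster_generator (m n : nat) (hnm : (n <= m)%N)
    (F : unitAlgType laurent) (S0 : seed m n F) : F -> Prop :=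
| generator_cluster S (i : 'I_n) : mutation_equiv hnm S0 S ->
    cluster_generator hnm S0 (cluster S (widen_ord hnm i))
| generator_frozen (i : 'I_m) : (n <= i)%N ->
    cluster_generator hnm S0 (cluster S0 i)
| generator_frozenV (i : 'I_m) : (n <= i)%N ->
    cluster_generator hnm S0 (cluster S0 i)^-1.

Definition quantum_cluster_algebra (m n : nat) (hnm : (n <= m)%N)
    (F : unitAlgType laurent) (S0 : seed m n F) : F -> Prop :=
  gen_subalg (cluster_generator hnm S0).

(* A Poisson structure on the subalgebra A of F; the values of br outside of A
   are unconstrained. *)
Record poisson_on (F : unitAlgType laurent) (A : F -> Prop) (br : F -> F -> F) :
    Prop := PoissonOn {
  poisson_closed : forall a b, A a -> A b -> A (br a b);
  poisson_linear_l : forall (t : laurent) a b c, A a -> A b -> A c ->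
    br (t *: a + b) c = t *: br a c + br b c;
  poisson_linear_r : forall (t : laurent) a b c, A a -> A b -> A c ->
    br a (t *: b + c) = t *: br a b + br a c;
  poisson_alternating : forall a, A a -> br a a = 0;
  poisson_jacobi : forall a b c, A a -> A b -> A c ->
    br a (br b c) + br b (br c a) + br c (br a b) = 0;
  poisson_leibniz : forall a b c, A a -> A b -> A c ->
    br a (b * c) = br a b * c + b * br a c }.

Definition log_canonical_with (m n : nat) (F : unitAlgType laurent)
    (br : F -> F -> F) (S : seed m n F) (om : 'M[laurent]_m) : Prop :=
  forall i j : 'I_m,
    br (cluster S i) (cluster S j) = om i j *: smonomial S (evec i + evec j).

Definition log_canonical (m n : nat) (F : unitAlgType laurent)
    (br : F -> F -> F) (S : seed m n F) : Prop :=
  exists om : 'M[laurent]_m, log_canonical_with br S om.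

(* Main.v *)
(* The bracket [br X_j] is a derivation, and it sends each monomial x with
   nonnegative exponents to a scalar multiple of x * X_j, its logarithmic
   derivative. Comparing the values of [br X_j] on x * y and y * x for
   q-commuting monomials x and y shows that conditions (i) and (ii) always hold.
   With b_k the k-th column and e = [b_k]_+, e' = [-b_k]_+, the exchange relation
   expresses X_k X_k' through X^e and X^e', both of which q-commute with X_j by
   the same factor since (B^T Lam)_kj = 0; hence X_k' has a logarithmic
   derivative iff those of X^e and X^e' agree. If some Lam_ju is nonzero this
   agreement is forced by comparison with X_u, and so is (iii), since then
   om_tj = 0 whenever Lam_tj = 0. Otherwise X_j is central and logarithmic
   derivatives are additive in the exponent, so the agreement is (iii). *)
Require Import Defs.
From mathcomp Require Import all_boot all_order all_algebra.
From mathcomp Require Import ring.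

Set Implicit Arguments.
Unset Strict Implicit.
Unset Printing Implicit Defensive.

Import Order.TTheory GRing.Theory Num.Theory.
Local Open Scope ring_scope.

(** * The ground ring: no zero divisors, and powers of q^(1/2) *)

Lemma laurent_val_inj : injective laurent_val.
Proof. exact: val_inj. Qed.

Lemma laurent_mulf_eq0 (x y : laurent) : x * y = 0 -> x = 0 \/ y = 0.
Proof.
move=> /(congr1 laurent_val) /= /eqP; rewrite mulf_eq0.
by case/orP => /eqP h; [left | right]; apply: laurent_val_inj.
Qed.

Lemma laurent_mulIf (a x y : laurent) : a != 0 -> x * a = y * a -> x = y.
Proof.
move=> a0 h; apply/eqP; rewrite -subr_eq0; apply/eqP.
have : (x - y) * a = 0 by rewrite mulrBl h subrr.
by case/laurent_mulf_eq0 => // a0'; rewrite a0' eqxx in a0.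
Qed.

Lemma qhalfD (a b : int) : qhalf (a + b) = qhalf a * qhalf b.
Proof. by apply: laurent_val_inj; rewrite /= expfzDr // qhalf_frac_neq0. Qed.

Lemma qhalf0 : qhalf 0 = 1.
Proof. exact: laurent_val_inj. Qed.

Lemma qhalfK (a : int) : qhalf a * qhalf (- a) = 1.
Proof. by rewrite -qhalfD subrr qhalf0. Qed.

Lemma qhalfVK (a : int) : qhalf (- a) * qhalf a = 1.
Proof. by rewrite -qhalfD addNr qhalf0. Qed.

(** X^n has size n + 1, so [qhalf_frac] is not a root of unity; inversion reduces negative exponents
    to this case. *)
Lemma qhalf_eq1 (a : int) : qhalf a = 1 -> a = 0.
Proof.
have nat_case n : qhalf_frac ^+ n = 1 -> n = 0%N.
  rewrite /qhalf_frac -tofracXn -tofrac1 => /eqP.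
  rewrite tofrac_eq => /eqP /(congr1 (fun p : {poly int} => size p)).
  by rewrite size_polyXn size_poly1 => -[].
move=> /(congr1 laurent_val); case: a => n /=; first by move=> /nat_case ->.
by rewrite NegzE -exprnN => /(congr1 GRing.inv); rewrite invrK invr1 => /nat_case.
Qed.

Lemma qhalf_neq0 (a : int) : qhalf a != 0.
Proof.
apply/eqP => h; have := qhalfK a; rewrite h mul0r => /eqP.
by rewrite eq_sym oner_eq0.
Qed.

Lemma qhalfZK (V : lmodType laurent) (a : int) (x : V) :
  qhalf (- a) *: (qhalf a *: x) = x.
Proof. by rewrite scalerA qhalfVK scale1r. Qed.

(** * Elements equal up to a power of [q^(1/2)] *)

Definition qeq (V : lmodType laurent) (x y : V) := exists z, x = qhalf z *: y.

Lemma qeq_refl (V : lmodType laurent) (x : V) : qeq x x.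
Proof. by exists 0; rewrite qhalf0 scale1r. Qed.

Lemma qeq_sym (V : lmodType laurent) (x y : V) : qeq x y -> qeq y x.
Proof. by case=> z ->; exists (- z); rewrite qhalfZK. Qed.

Lemma qeq_trans (V : lmodType laurent) (y x z : V) :
  qeq x y -> qeq y z -> qeq x z.
Proof. by move=> [a ->] [b ->]; exists (a + b); rewrite scalerA qhalfD. Qed.

Lemma qeqZ (V : lmodType laurent) (a : int) (x : V) : qeq (qhalf a *: x) x.
Proof. by exists a. Qed.

Lemma qeqM (F : unitAlgType laurent) (x x' y y' : F) :
  qeq x x' -> qeq y y' -> qeq (x * y) (x' * y').
Proof.
by move=> [a ->] [b ->]; exists (a + b); rewrite -scalerAl -scalerAr scalerA qhalfD.
Qed.

Lemma qeqMl (F : unitAlgType laurent) (x y y' : F) :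
  qeq y y' -> qeq (x * y) (x * y').
Proof. by move=> h; apply: qeqM h; apply: qeq_refl. Qed.

Lemma qeqMr (F : unitAlgType laurent) (x x' y : F) :
  qeq x x' -> qeq (x * y) (x' * y).
Proof. by move=> h; apply: (qeqM h); apply: qeq_refl. Qed.

Lemma qeq_expz_comm (F : unitAlgType laurent) (x y : F) (a : int) :
  x \is a GRing.unit -> y \is a GRing.unit ->
  qeq (x * y) (y * x) -> qeq (x * y ^ a) (y ^ a * x).
Proof.
move=> ux uy xy.
have pos (z : F) n : qeq (x * z) (z * x) -> qeq (x * z ^+ n) (z ^+ n * x).
  move=> xz; elim: n => [|n IHn]; first by rewrite expr0 mulr1 mul1r; apply: qeq_refl.
  rewrite exprS mulrA; apply: (@qeq_trans _ (z * x * z ^+ n)).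
    by apply: qeqMr.
  by rewrite -!mulrA; apply: qeqMl.
case: a => n; first exact: pos.
rewrite NegzE -exprz_inv; apply: (pos _ n.+1).
(* Multiplying by y^-1 on both sides turns the relation between y * x and x * y into the one for
   y^-1. *)
have -> : x * y^-1 = y^-1 * (y * x) * y^-1 by rewrite mulKr.
have -> : y^-1 * x = y^-1 * (x * y) * y^-1 by rewrite -mulrA mulrK.
by apply: qeqMr; apply: qeqMl; apply: qeq_sym.
Qed.

(** * Ordered products of q-commuting units *)

Section NormalizedMonomials.
Context (m : nat) (F : unitAlgType laurent) (Y : 'I_m -> F).
Hypothesis unitY : forall i, Y i \is a GRing.unit.
Hypothesis commY : forall i j, qeq (Y i * Y j) (Y j * Y i).

Lemma qeq_prod_comm (r : seq 'I_m) (e : 'I_m -> int) (x : F) :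
  (forall i, qeq (x * Y i ^ e i) (Y i ^ e i * x)) ->
  qeq (x * \prod_(i <- r) Y i ^ e i) ((\prod_(i <- r) Y i ^ e i) * x).
Proof.
move=> xY; elim: r => [|i r IHr].
  by rewrite big_nil mulr1 mul1r; apply: qeq_refl.
rewrite big_cons mulrA; apply: (@qeq_trans _ (Y i ^ e i * x * \prod_(j <- r) Y j ^ e j)).
  by apply: qeqMr.
by rewrite -!mulrA; apply: qeqMl.
Qed.

Lemma qeq_prodD (r : seq 'I_m) (e f : 'I_m -> int) :
  qeq (\prod_(i <- r) Y i ^ (e i + f i))
      ((\prod_(i <- r) Y i ^ e i) * \prod_(i <- r) Y i ^ f i).
Proof.
elim: r => [|i r IHr]; first by rewrite !big_nil mulr1; apply: qeq_refl.
rewrite !big_cons exprzDr // -!mulrA; apply: qeqMl.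
apply: (qeq_trans (qeqMl _ IHr)).
(* It remains to move Y_i^(f_i) past the powers Y_j^(e_j) of the remaining factors. *)
rewrite !mulrA; apply: qeqMr; apply: qeq_prod_comm => j.
apply: qeq_expz_comm => //; first exact: unitrXz.
by apply: qeq_sym; apply: qeq_expz_comm.
Qed.

Lemma prod_evec (i : 'I_m) : \prod_(l < m) Y l ^ evec i 0 l = Y i.
Proof.
rewrite -[RHS](@big_pred1_eq _ 1 *%R _ i Y) big_mkcond /=.
apply: eq_bigr => l _; rewrite mxE eqxx /=.
by case: eqP => // _; rewrite expr1z.
Qed.

(** The form [Lam] is arbitrary and contributes only a power of q^(1/2). Log-canonicity allows any
    scalar coefficients, so this comparison is precise enough for the monomials of the mutated
    seed. *)
Lemma qeq_nmonomial2 (Lam : 'M[int]_m) (i j : 'I_m) :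
  qeq (nmonomial Lam Y (evec i + evec j)) (Y i * Y j).
Proof.
apply: (qeq_trans (qeqZ _ _)).
rewrite -(prod_evec i) -(prod_evec j).
under eq_bigr => l _ do rewrite mxE.
exact: qeq_prodD.
Qed.

End NormalizedMonomials.

(** * The quantum torus *)

Section Torus.
Context (m : nat) (Lam : 'M[int]_m) (F : unitAlgType laurent).
Context (T : 'rV[int]_m -> F) (hF : torus_fractions Lam T).
Hypothesis skewLam : skew_symmetric Lam.

Definition pairing (e f : 'rV[int]_m) : int := (e *m Lam *m f^T) 0 0.

Lemma torusM e f : T e * T f = qhalf (pairing e f) *: T (e + f).
Proof. exact: (torus_mul hF). Qed.

Lemma pairingDr e f f' : pairing e (f + f') = pairing e f + pairing e f'.
Proof. by rewrite /pairing linearD mulmxDr mxE. Qed.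

Lemma pairingZl a e f : pairing (a *: e) f = a * pairing e f.
Proof. by rewrite /pairing -!scalemxAl mxE. Qed.

Lemma pairingZr a e f : pairing e (a *: f) = a * pairing e f.
Proof. by rewrite /pairing linearZ -scalemxAr mxE. Qed.

Lemma pairingNr e f : pairing e (- f) = - pairing e f.
Proof. by rewrite -scaleN1r pairingZr mulN1r. Qed.

Lemma pairingC e f : pairing e f = - pairing f e.
Proof.
rewrite /pairing; have -> : e *m Lam *m f^T = - (f *m Lam *m e^T)^T.
  by rewrite !trmx_mul trmxK skewLam mulNmx mulmxN opprK mulmxA.
by rewrite !mxE.
Qed.

Lemma pairing_alt e : pairing e e = 0.
Proof.
have /eqP : pairing e e = - pairing e e by apply: pairingC.
by rewrite -subr_eq0 opprK -mulr2n mulrn_eq0 /= => /eqP.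
Qed.

Lemma pairing_evec i j : pairing (evec i) (evec j) = Lam i j.
Proof. by rewrite /pairing /evec trmx_delta -rowE -colE !mxE. Qed.

Lemma pairing_sumr (I : Type) (r : seq I) (f : I -> 'rV[int]_m) e :
  pairing e (\sum_(i <- r) f i) = \sum_(i <- r) pairing e (f i).
Proof.
elim: r => [|i r IHr]; last by rewrite !big_cons pairingDr IHr.
by rewrite !big_nil /pairing trmx0 mulmx0 mxE.
Qed.

Lemma torus_neq0 e : T e != 0.
Proof.
apply/eqP => Te0.
have /(_ isT) := @torus_free _ _ _ _ hF [:: e] (fun=> 1).
rewrite big_seq1 scale1r => /(_ Te0 e (mem_head _ _)) /eqP.
by rewrite oner_eq0.
Qed.

Lemma torus_unit e : T e \is a GRing.unit.
Proof. exact: (fractions_division hF) (torus_neq0 e). Qed.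

Lemma torus0 : T 0 = 1.
Proof.
apply: (mulrI (torus_unit 0)).
by rewrite torusM addr0 mulr1 pairing_alt qhalf0 scale1r.
Qed.

Lemma torusX e n : T e ^+ n = T (n%:Z *: e).
Proof.
elim: n => [|n IHn]; first by rewrite expr0 scale0r torus0.
rewrite exprS IHn torusM pairingZr pairing_alt mulr0 qhalf0 scale1r.
by rewrite intS scalerDl scale1r.
Qed.

Lemma torusV e : (T e)^-1 = T (- e).
Proof.
apply: (mulrI (torus_unit e)); rewrite mulrV ?torus_unit //.
by rewrite torusM pairingNr pairing_alt oppr0 qhalf0 scale1r subrr torus0.
Qed.

Lemma torusXz e (a : int) : T e ^ a = T (a *: e).
Proof.
case: a => n; first exact: torusX.
by rewrite NegzE -exprz_inv torusV -exprnP torusX scalerN scaleNr.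
Qed.

Lemma torusC e f : T e * T f = qhalf (pairing e f *+ 2) *: (T f * T e).
Proof.
by rewrite !torusM scalerA -qhalfD (pairingC f) addrC (addrC f) mulr2n addrK.
Qed.

(** Dividing by the unit x leaves a multiple of the single basis element [T 0], which is 1. *)
Lemma scale_eq0_div (a : laurent) (x : F) : a *: x = 0 -> x != 0 -> a = 0.
Proof.
move=> ax0 /(fractions_division hF) ux.
have := @torus_free _ _ _ _ hF [:: 0] (fun=> a) isT; rewrite big_seq1 torus0 => h.
apply: (h _ 0) (mem_head _ _); apply: (mulIr ux).
by rewrite mul0r -scalerAl mul1r.
Qed.

Lemma scale_inj_div (a b : laurent) (x : F) : x != 0 -> a *: x = b *: x -> a = b.
Proof.
move=> x0 h; apply/eqP; rewrite -subr_eq0; apply/eqP.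
by apply: scale_eq0_div x0; rewrite scalerBl h subrr.
Qed.

Lemma torus_free2 e f (a b : laurent) : e != f ->
  a *: T e + b *: T f = 0 -> a = 0 /\ b = 0.
Proof.
move=> nef h.
have := @torus_free _ _ _ _ hF [:: e; f] (fun g => if g == e then a else b).
rewrite /= inE nef big_cons big_seq1 eqxx [f == e]eq_sym (negPf nef) => /(_ isT h) h2.
split; first by have := h2 e (mem_head _ _); rewrite eqxx.
by have := h2 f; rewrite !inE eqxx orbT [f == e]eq_sym (negPf nef) => /(_ isT).
Qed.

(** Each factor pairs with the sum of the later exponents; as r increases strictly, the later
    indices are exactly the larger ones. *)
Lemma torus_prod (r : seq 'I_m) (f : 'I_m -> 'rV[int]_m) :
  sorted (fun i j : 'I_m => i < j)%N r ->
  \prod_(i <- r) T (f i) =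
  qhalf (\sum_(i <- r) \sum_(j <- r | (i < j)%N) pairing (f i) (f j))
    *: T (\sum_(i <- r) f i).
Proof.
have tr : transitive (fun i j : 'I_m => i < j)%N by move=> ? ? ?; apply: ltn_trans.
elim: r => [|i r IHr]; first by rewrite !big_nil qhalf0 scale1r torus0.
rewrite /= path_sortedE // => /andP[/allP lti /IHr {IHr} IHr].
rewrite !big_cons IHr -scalerAr torusM scalerA -qhalfD; congr (qhalf _ *: _).
rewrite ltnn pairing_sumr addrC; congr (_ + _).
  rewrite [RHS]big_mkcond big_seq [RHS]big_seq.
  by apply: eq_bigr => j /lti ->.
rewrite big_seq [RHS]big_seq; apply: eq_bigr => j /lti ij.
by rewrite big_cons ltnNge (ltnW ij).
Qed.

Lemma index_enum_ord_sorted :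
  sorted (fun i j : 'I_m => i < j)%N (index_enum 'I_m).
Proof.
have -> : index_enum 'I_m = enum 'I_m by rewrite enumT /index_enum unlock.
by have := iota_ltn_sorted 0 m; rewrite -val_enum_ord sorted_map.
Qed.

(** The prefactor in [nmonomial] is inverse to the power of q^(1/2) produced by [torus_prod]. *)
Lemma nmonomial_torus e : nmonomial Lam (fun i => T (evec i)) e = T e.
Proof.
rewrite /nmonomial; under [\prod_(i < m) _]eq_bigr => i _ do rewrite torusXz.
rewrite torus_prod ?index_enum_ord_sorted // scalerA -qhalfD.
set s := (X in qhalf X); have -> : s = 0.
  rewrite /s addrC; apply/eqP; rewrite subr_eq0; apply/eqP.
  apply: eq_bigr => i _; apply: eq_bigr => j _.
  by rewrite pairingZl pairingZr pairing_evec mulrA mulrC mulrA.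
rewrite qhalf0 scale1r; by congr T; rewrite [RHS]row_sum_delta.
Qed.

End Torus.

(** * Logarithmic derivatives with respect to [br X] *)

Section LogDerivation.
Context (F : unitAlgType laurent) (G : F -> Prop) (br : F -> F -> F).
Hypothesis hP : poisson_on (gen_subalg G) br.
Local Notation A := (gen_subalg G).

Lemma gen_subalgZ (a : laurent) x : A x -> A (a *: x).
Proof. by move=> Ax; rewrite -mulr_algl; apply: gen_mul; first exact: gen_scalar. Qed.

Lemma gen_subalg1 : A 1.
Proof. by rewrite -[1]scale1r; apply: gen_scalar. Qed.

Lemma gen_subalg0 : A 0.
Proof. by rewrite -[0](scale0r 1); apply: gen_scalar. Qed.

Lemma bracketDr a b c : A a -> A b -> A c -> br a (b + c) = br a b + br a c.
Proof. by move=> Aa Ab Ac; have := poisson_linear_r hP 1 Aa Ab Ac; rewrite !scale1r. Qed.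

Lemma bracketDl a b c : A a -> A b -> A c -> br (a + b) c = br a c + br b c.
Proof. by move=> Aa Ab Ac; have := poisson_linear_l hP 1 Aa Ab Ac; rewrite !scale1r. Qed.

Lemma bracket0r a : A a -> br a 0 = 0.
Proof.
move=> Aa; have := bracketDr Aa gen_subalg0 gen_subalg0.
by rewrite addr0 -[X in X = _]addr0 => /addrI.
Qed.

Lemma bracketZr (t : laurent) a b : A a -> A b -> br a (t *: b) = t *: br a b.
Proof.
move=> Aa Ab; have := poisson_linear_r hP t Aa Ab gen_subalg0.
by rewrite bracket0r // !addr0.
Qed.

Lemma bracketC a b : A a -> A b -> br b a = - br a b.
Proof.
move=> Aa Ab; apply/eqP; rewrite -addr_eq0 addrC; apply/eqP.
have Aab := gen_add Aa Ab; have := poisson_alternating hP Aab.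
by rewrite bracketDl // !bracketDr // !(poisson_alternating hP) // add0r addr0.
Qed.

Context (X : F) (AX : A X).

(** Membership in A is included because [br] is controlled only there. The factor X stays on the
    right of x, which fixes a convention, as X and x need not commute. *)
Definition dlog (x : F) (d : laurent) : Prop := A x /\ br X x = d *: (x * X).

Lemma dlog1 : dlog 1 0.
Proof.
split; first exact: gen_subalg1.
have := poisson_leibniz hP AX gen_subalg1 gen_subalg1.
by rewrite !mulr1 !mul1r scale0r -[X in X = _]addr0 => /addrI <-.
Qed.

Lemma dlogZ a x d : dlog x d -> dlog (a *: x) d.
Proof.
case=> Ax h; split; first exact: gen_subalgZ.
by rewrite bracketZr // h -scalerAl !scalerA mulrC.
Qed.

Lemma dlogD x y d : dlog x d -> dlog y d -> dlog (x + y) d.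
Proof.
move=> [Ax hx] [Ay hy]; split; first exact: gen_add.
by rewrite bracketDr // hx hy mulrDl scalerDr.
Qed.

(** The Leibniz rule gives d x X y + d' x y X, and moving X past y multiplies the first term by
    c. *)
Lemma dlogM x y d d' c :
  X * y = c *: (y * X) -> dlog x d -> dlog y d' -> dlog (x * y) (c * d + d').
Proof.
move=> Xy [Ax hx] [Ay hy]; split; first exact: gen_mul.
rewrite (poisson_leibniz hP) // hx hy -scalerAl -(mulrA x X) Xy -!scalerAr scalerA.
by rewrite scalerDl mulrA (mulrC c).
Qed.

(** The inverse of x need not lie in A, so the Leibniz rule is applied to x * y and x is cancelled
    in F. *)
Lemma dlog_cancel x y d d' c :
  x \is a GRing.unit -> A y -> X * y = c *: (y * X) ->
  dlog x d -> dlog (x * y) d' -> dlog y (d' - c * d).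
Proof.
move=> ux Ay Xy [Ax hx] [Axy]; rewrite (poisson_leibniz hP) // hx => hxy.
split=> //; apply: (mulrI ux); move: hxy.
rewrite -scalerAl -(mulrA x X) Xy -!scalerAr scalerA => /(canRL (addKr _)) ->.
by rewrite scalerBl mulrA (mulrC c) addrC.
Qed.

End LogDerivation.

(** * Logarithmic derivatives of monomials in the initial cluster *)

Section TorusDlog.
Context (m : nat) (Lam : 'M[int]_m) (F : unitAlgType laurent).
Context (T : 'rV[int]_m -> F) (hF : torus_fractions Lam T).
Hypothesis skewLam : skew_symmetric Lam.
Context (G : F -> Prop) (br : F -> F -> F).
Hypothesis hP : poisson_on (gen_subalg G) br.
Hypothesis AT : forall i, gen_subalg G (T (evec i)).
Context (om : 'M[laurent]_m).
Hypothesis hom : forall i j,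
  br (T (evec i)) (T (evec j)) = om i j *: T (evec i + evec j).

Lemma om_skew i j : om j i = - om i j.
Proof.
apply: (scale_inj_div hF skewLam (torus_neq0 hF (evec i + evec j))).
by rewrite scaleNr -hom addrC -hom (bracketC hP).
Qed.

Context (j : 'I_m).
Local Notation X := (T (evec j)).
Local Notation Dlog := (dlog G br X).
(** The factor in X * T f = chi f *: (T f * X), multiplicative in f. *)
Local Notation chi f := (qhalf (pairing Lam (evec j) f *+ 2)).

(** The power of q^(1/2) converts the normalized monomial of e_i + e_j into the product X_i X_j. *)
Lemma dlog_evec i : Dlog (T (evec i)) (om j i * qhalf (Lam j i)).
Proof.
split=> //; rewrite hom (torusM hF) (pairing_evec Lam) (addrC (evec i)).
rewrite scalerA -mulrA -qhalfD -(pairing_evec Lam j) (pairingC skewLam).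
by rewrite pairing_evec addNr qhalf0 mulr1.
Qed.

Lemma dlog_torusD e f d d' :
  Dlog (T e) d -> Dlog (T f) d' -> Dlog (T (e + f)) (chi f * d + d').
Proof.
move=> he hf; have := dlogM hP (AT j) (torusC hF skewLam (evec j) f) he hf.
by move/(dlogZ hP (AT j) (qhalf (- pairing Lam e f))); rewrite (torusM hF) qhalfZK.
Qed.

Lemma dlog_inj x d d' : x != 0 -> Dlog x d -> Dlog x d' -> d = d'.
Proof.
move=> x0 [_ h] [_]; rewrite h => /(scale_inj_div hF skewLam) -> //.
by rewrite mulIr_eq0 //; apply: mulIr; apply: (torus_unit hF).
Qed.

(* Both [T (e + f)] and [T (f + e)] are given by the Leibniz rule. *)
Lemma dlog_torus_comm e f d d' :
  Dlog (T e) d -> Dlog (T f) d' -> d * (chi f - 1) = d' * (chi e - 1).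
Proof.
move=> he hf; have h1 := dlog_torusD he hf; have := dlog_torusD hf he.
rewrite addrC => /(dlog_inj (torus_neq0 hF _) h1) h.
apply/eqP; rewrite !mulrBr !mulr1 subr_eq addrAC eq_sym subr_eq.
by rewrite (mulrC d) (mulrC d') h.
Qed.

(** This is [dlog_torus_comm] for two cluster variables, in symmetric form. Conditions (i) and (ii)
    are instances of it. *)
Lemma om_compat u v :
  om u j * (qhalf (Lam v j) - qhalf (Lam j v)) =
  om v j * (qhalf (Lam u j) - qhalf (Lam j u)).
Proof.
have LamC i : Lam i j = - Lam j i.
  by rewrite -!(pairing_evec Lam) (pairingC skewLam).
(* Splitting off a square root turns each [chi] minus 1 into a difference of opposite powers. *)
have sq i : qhalf (i *+ 2) - 1 = qhalf i * (qhalf i - qhalf (- i)).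
  by rewrite mulrBr qhalfK -qhalfD -mulr2n.
have := dlog_torus_comm (dlog_evec u) (dlog_evec v).
rewrite !pairing_evec !sq => h.
apply: (laurent_mulIf (qhalf_neq0 (Lam j u + Lam j v))).
rewrite !LamC qhalfD !(om_skew j).
transitivity (om j u * qhalf (Lam j u)
              * (qhalf (Lam j v) * (qhalf (Lam j v) - qhalf (- Lam j v)))).
  by ring.
by rewrite h; ring.
Qed.

(** The additive extension of row j of [om] to all exponents: the logarithmic derivative when X_j is
    central. *)
Definition om_lin (e : 'rV[int]_m) : laurent := \sum_i om j i *~ e 0 i.

Lemma om_linD e f : om_lin (e + f) = om_lin e + om_lin f.
Proof.
by rewrite /om_lin -big_split; apply: eq_bigr => i _; rewrite mxE mulrzDr.
Qed.

Lemma om_linB e f : om_lin (e - f) = om_lin e - om_lin f.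
Proof. by apply: (addIr (om_lin f)); rewrite -om_linD !subrK. Qed.

Lemma om_lin_evec i : om_lin (evec i) = om j i.
Proof.
rewrite /om_lin (bigD1 i) //= mxE !eqxx mulr1z big1 ?addr0 // => l li.
by rewrite mxE eqxx (negPf li) mulr0z.
Qed.

(** Nonnegative exponents keep T e in A, as a product of the X_i up to a power of q^(1/2). If row j
    of [Lam] vanishes, every [chi] is 1 and the twisted Leibniz rule becomes additive. *)
Lemma dlog_torus_pos (e : 'rV[int]_m) : (forall i, 0 <= e 0 i) ->
  exists2 d, Dlog (T e) d & (forall i, Lam j i = 0) -> d = om_lin e.
Proof.
move=> e0; pose K f := exists2 d, Dlog (T f) d
                       & (forall i, Lam j i = 0) -> d = om_lin f.
have K0 : K 0.
  exists 0; first by rewrite (torus0 hF skewLam); apply: (dlog1 hP).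
  by rewrite -[in RHS](subrr (0 : 'rV[int]_m)) om_linB subrr.
have KD f g : K f -> K g -> K (f + g).
  move=> [d hd df] [d' hd' dg]; exists (chi g * d + d'); first exact: dlog_torusD.
  move=> j0; rewrite om_linD -df // -dg //; congr (_ + _).
  suff -> : pairing Lam (evec j) g = 0 by rewrite mul0rn qhalf0 mul1r.
  rewrite /pairing /evec -rowE mxE big1 // => l _.
  by rewrite mxE j0 mul0r.
have Kevec i : K (evec i).
  exists (om j i * qhalf (Lam j i)); first exact: dlog_evec.
  by move=> j0; rewrite j0 qhalf0 mulr1 om_lin_evec.
have KX i n : K (n%:Z *: evec i).
  elim: n => [|n IHn]; first by rewrite scale0r.
  by rewrite intS scalerDl scale1r; apply: KD.
rewrite -/(K e) (row_sum_delta e); apply: big_ind => // i _.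
by case: (e 0 i) (e0 i) => // n _; apply: KX.
Qed.

(* When [Lam j u != 0] for some [u], [dlog_torus_comm] against [T (evec u)]
   determines the logarithmic derivatives; otherwise they are additive. *)
Lemma dlog_torus_eq (e e' : 'rV[int]_m) d d' :
  (forall i, 0 <= e 0 i) -> (forall i, 0 <= e' 0 i) ->
  pairing Lam (evec j) e = pairing Lam (evec j) e' ->
  Dlog (T e) d -> Dlog (T e') d' ->
  d = d' <-> \sum_(t < m | Lam t j == 0) om t j *~ (e - e') 0 t = 0.
Proof.
move=> e0 e0' ee' hd hd'.
have LamC i : Lam i j = - Lam j i.
  by rewrite -!(pairing_evec Lam) (pairingC skewLam).
have [/forallP /= j0|] := boolP [forall i, Lam j i == 0].
  have j0' i : Lam j i = 0 by apply/eqP.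
  have [d1 h1 /(_ j0') d1E] := dlog_torus_pos e0.
  have [d1' h1' /(_ j0') d1E'] := dlog_torus_pos e0'.
  rewrite (dlog_inj (torus_neq0 hF _) hd h1) (dlog_inj (torus_neq0 hF _) hd' h1').
  have -> : \sum_(t < m | Lam t j == 0) om t j *~ (e - e') 0 t = - (d1 - d1').
    rewrite d1E d1E' -om_linB -sumrN; apply: eq_big => t.
      by rewrite LamC j0' oppr0 eqxx.
    by rewrite (om_skew t j) mulNrz opprK.
  split=> [->|/eqP]; first by rewrite subrr oppr0.
  by rewrite oppr_eq0 subr_eq0 => /eqP.
rewrite negb_forall => /existsP[u ju0].
have chi1 : qhalf (Lam j u *+ 2) - 1 != 0.
  rewrite subr_eq0; apply: contra ju0 => /eqP /qhalf_eq1 /eqP.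
  by rewrite mulrn_eq0.
split=> _.
  (* Since Lam_tj = 0, the right side of [om_compat] vanishes; the cofactor of om_tj on the left is,
     up to sign and a power of q^(1/2), the nonzero [chi] of e_u minus 1. *)
  rewrite big1 // => t /eqP t0; have := om_compat t u.
  rewrite t0 -[Lam j t]opprK -LamC t0 oppr0 subrr mulr0 LamC.
  case/laurent_mulf_eq0 => [->|]; first by rewrite mul0rz.
  move=> h; case/eqP: chi1; move/(congr1 (fun x => - (x * qhalf (Lam j u)))): h.
  by rewrite mul0r oppr0 mulrBl qhalfVK -qhalfD -mulr2n opprB.
apply: (laurent_mulIf chi1); rewrite -(pairing_evec Lam).
by rewrite (dlog_torus_comm hd (dlog_evec u)) ee' (dlog_torus_comm hd' (dlog_evec u)).
Qed.

(** With f = e_k the sum is the mutated variable. Multiplying it by T f gives a combination of T e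
    and T e' with invertible coefficients, whose logarithmic derivative exists exactly when theirs
    agree. *)
Lemma dlog_mutation (e e' f : 'rV[int]_m) d d' d1 :
  e != e' -> pairing Lam (evec j) e = pairing Lam (evec j) e' ->
  gen_subalg G (T (- f + e) + T (- f + e')) ->
  Dlog (T f) d1 -> Dlog (T e) d -> Dlog (T e') d' ->
  (exists c, Dlog (T (- f + e) + T (- f + e')) c) <-> d = d'.
Proof.
move=> nee' ee' AY hf he he'.
have XY : X * (T (- f + e) + T (- f + e'))
          = chi (- f + e) *: ((T (- f + e) + T (- f + e')) * X).
  rewrite mulrDr mulrDl scalerDr !(torusC hF skewLam (evec j)).
  by rewrite !(pairingDr _ _ (- f)) ee'.
have ME : T f * (T (- f + e) + T (- f + e'))
    = qhalf (pairing Lam f (- f + e)) *: T e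
      + qhalf (pairing Lam f (- f + e')) *: T e'.
  by rewrite mulrDr !(torusM hF) !addNKr.
split=> [[c hc]|dd'].
  have := dlogM hP (AT j) XY hf hc; move: (_ + c : laurent) => c'; rewrite ME => -[_].
  case: he he' => Ae De [Ae' De'].
  rewrite (bracketDr hP) ?(bracketZr hP) ?De ?De' //; do ?[exact: gen_subalgZ].
  rewrite !scalerAl -mulrDl => /(mulIr (torus_unit hF (evec j))) /eqP.
  (* Comparing coefficients of the independent T e and T e' shows that d and d' both equal c'. *)
  rewrite -subr_eq0 scalerDr !scalerA opprD addrACA -!scalerBl => /eqP /(torus_free2 hF nee')[].
  rewrite ![c' * _]mulrC -!mulrBr.
  case/laurent_mulf_eq0 => [/eqP|/eqP]; first by rewrite (negPf (qhalf_neq0 _)).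
  rewrite subr_eq0 => /eqP ->.
  case/laurent_mulf_eq0 => [/eqP|/eqP]; first by rewrite (negPf (qhalf_neq0 _)).
  by rewrite subr_eq0 => /eqP ->.
rewrite -dd' in he'; eexists; apply: (dlog_cancel hP (AT j) (torus_unit hF f) AY XY hf).
by rewrite ME; apply: (dlogD hP (AT j)); apply: (dlogZ hP (AT j)); [exact: he|].
Qed.

End TorusDlog.

(** * The criterion for log-canonicity of the mutated cluster *)

Unset Implicit Arguments.

Theorem theorem2p5 (m n : nat) (hnm : (n <= m)%N)
    (Bt : 'M[int]_(m, n)) (Lam : 'M[int]_m)
    (hcomp : compatible_pair hnm Bt Lam)
    (F : unitAlgType laurent) (T : 'rV[int]_m -> F)
    (hF : torus_fractions Lam T)
    (br : F -> F -> F) (om : 'M[laurent]_m) (k : 'I_n) :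
  let S := Seed (fun i => T (evec i)) Bt Lam in
  let kk := widen_ord hnm k in
  poisson_on (quantum_cluster_algebra hnm S) br ->
  log_canonical_with br S om ->
  (log_canonical br (mutation hnm k S) <->
   forall j : 'I_m, j != kk ->
     [/\ forall u : 'I_m, Bt u k != 0 ->
           om u j * (qhalf (Lam kk j) - qhalf (Lam j kk))
           = om kk j * (qhalf (Lam u j) - qhalf (Lam j u)),
         forall u v : 'I_m, Bt u k * Bt v k != 0 ->
           om u j * (qhalf (Lam v j) - qhalf (Lam j v))
           = om v j * (qhalf (Lam u j) - qhalf (Lam j u))
       & \sum_(t < m | Lam t j == 0) om t j *~ Bt t k = 0]).
Proof.
move=> S kk hP hS; case: (hcomp) => skewLam [d [dpos _] hBt].
have AT i : quantum_cluster_algebra hnm S (T (evec i)).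
  have [lin|nlei] := ltnP i n; apply: gen_in; last exact: (generator_frozen hnm S).
  have := @generator_cluster _ _ hnm _ S S (Ordinal lin) (mutation_refl hnm S).
  by rewrite /=; congr (cluster_generator _ _ (T (evec _))); apply: val_inj.
have hom i j : br (T (evec i)) (T (evec j)) = om i j *: T (evec i + evec j).
  by rewrite (hS i j) /smonomial /= (nmonomial_torus hF skewLam).
pose e : 'rV[int]_m := \row_l pos_part (Bt l k).
pose e' : 'rV[int]_m := \row_l pos_part (- Bt l k).
pose Y := T (- evec kk + e) + T (- evec kk + e').
have ee'E : e - e' = row k Bt^T.
  apply/rowP => t; rewrite !mxE /pos_part /Num.max oppr_lt0.
  by case: ltrgtP => [_|_|->]; rewrite ?subr0 ?sub0r ?opprK ?oppr0.
have cluster_mut i : cluster (mutation hnm k S) i = if i == kk then Y else T (evec i).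
  rewrite /= /mut_cluster /= -/kk; case: eqP => // _.
  by rewrite /smonomial /= !(nmonomial_torus hF skewLam).
have row_k t : (row k Bt^T *m Lam) 0 t = if kk == t then d 0 k else 0.
  by rewrite -row_mul hBt !mxE.
(* The difference of the two pairings is -(Bt^T Lam)_kj, which compatibility makes zero off the
   diagonal. *)
have pair_e j : j != kk -> pairing Lam (evec j) e = pairing Lam (evec j) e'.
  move=> jk; apply/eqP; rewrite -subr_eq0 -pairingNr -pairingDr ee'E.
  rewrite (pairingC skewLam) /pairing /evec trmx_delta -colE mxE row_k.
  by rewrite (eq_sym kk) (negPf jk) oppr0.
(* Equality would make the k-th column of [Bt] zero, against (Bt^T Lam)_kk = d_k > 0. *)
have nee' : e != e'.
  apply/eqP => E; have := row_k kk; rewrite -ee'E E subrr mul0mx mxE eqxx => d0.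
  by have := dpos k; rewrite -d0 ltxx.
have AY : quantum_cluster_algebra hnm S Y.
  have St := mutation_step k (mutation_refl hnm S).
  by have := generator_cluster k St; rewrite cluster_mut eqxx; apply: gen_in.
(* Invertibility gives meaning to the integer powers of Y in [nmonomial]; Y is nonzero because its
   two monomials are distinct. *)
have Y_unit : Y \is a GRing.unit.
  apply: (fractions_division hF); apply/eqP => Y0.
  have : 1 *: T (- evec kk + e) + 1 *: T (- evec kk + e') = 0 by rewrite !scale1r.
  case/(torus_free2 hF); first by rewrite (inj_eq (addrI _)).
  by move/eqP; rewrite oner_eq0.
have XY j : j != kk -> qeq (T (evec j) * Y) (Y * T (evec j)).
  move=> jk; exists (pairing Lam (evec j) (- evec kk + e) *+ 2).
  rewrite mulrDr mulrDl scalerDr !(torusC hF skewLam (evec j)).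
  by rewrite !(pairingDr _ _ (- evec kk)) (pair_e j jk).
have smono2 i j : qeq (smonomial (mutation hnm k S) (evec i + evec j))
    (cluster (mutation hnm k S) i * cluster (mutation hnm k S) j).
  apply: qeq_nmonomial2 => [l|l l']; rewrite !cluster_mut.
    by case: eqP => // _; apply: (torus_unit hF).
  case: (eqVneq l kk) => [_|lk]; case: (eqVneq l' kk) => [_|lk'].
  - exact: qeq_refl.
  - by apply: qeq_sym; apply: XY.
  - exact: XY.
  - by eexists; apply: (torusC hF skewLam).
have key j : j != kk ->
    (exists c, dlog (cluster_generator hnm S) br (T (evec j)) Y c) <->
    \sum_(t < m | Lam t j == 0) om t j *~ Bt t k = 0.
  move=> jk; have e0 i : 0 <= e 0 i by rewrite mxE /pos_part le_max lexx orbT.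
  have e0' i : 0 <= e' 0 i by rewrite mxE /pos_part le_max lexx orbT.
  have [c hc _] := dlog_torus_pos hF skewLam hP AT hom j e0.
  have [c' hc' _] := dlog_torus_pos hF skewLam hP AT hom j e0'.
  have hk := dlog_evec hF skewLam AT hom j kk.
  rewrite (dlog_mutation hF skewLam hP AT nee' (pair_e j jk) AY hk hc hc').
  rewrite (dlog_torus_eq hF skewLam hP AT hom e0 e0' (pair_e j jk) hc hc') ee'E.
  by under eq_bigr => t _ do rewrite !mxE.
split=> [[om' hom'] j jk|H].
  split=> [u _|u v _|]; do ?exact: (om_compat hF skewLam hP AT hom).
  (* Up to powers of q^(1/2), the normalized monomial in the bracket of X_j with Y is Y * X_j, so Y
     has a logarithmic derivative. *)
  apply/(key j jk); have := hom' j kk; have [z ->] := smono2 j kk.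
  rewrite !cluster_mut (negPf jk) eqxx; have [w ->] := XY j jk => E.
  by eexists; split; [exact: AY | rewrite E !scalerA].
have ex i j : exists w, br (cluster (mutation hnm k S) i) (cluster (mutation hnm k S) j)
    = w *: smonomial (mutation hnm k S) (evec i + evec j).
  have [w hw] : exists w, br (cluster (mutation hnm k S) i) (cluster (mutation hnm k S) j)
     = w *: (cluster (mutation hnm k S) i * cluster (mutation hnm k S) j); last first.
    by rewrite hw; have [z ->] := qeq_sym (smono2 i j); rewrite scalerA; eexists.
  (* By [key], condition (iii) supplies the brackets with Y; pairs avoiding [kk] keep their old
     brackets. *)
  have jY l : l != kk -> exists w, br (T (evec l)) Y = w *: (Y * T (evec l)).
    by move=> lk; have [_ _ /(key l lk)[c [_ ?]]] := H l lk; exists c.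
  rewrite !cluster_mut; case: (eqVneq i kk) => [_|ik]; case: (eqVneq j kk) => [_|jk].
  - by exists 0; rewrite (poisson_alternating hP) // scale0r.
  - have [w hw] := jY j jk; exists (- w).
    by rewrite (bracketC hP (AT j) AY) hw scaleNr.
  - have [w hw] := jY i ik; have [z E] := qeq_sym (XY i ik).
    by rewrite hw E scalerA; eexists.
  - exists (om i j * qhalf (- Lam i j)).
    by rewrite hom (torusM hF) pairing_evec scalerA -mulrA qhalfVK mulr1.
have {ex}/fin_all_exists[om' hom'] : forall i, exists w : {ffun 'I_m -> laurent},
    forall j, br (cluster (mutation hnm k S) i) (cluster (mutation hnm k S) j)
      = w j *: smonomial (mutation hnm k S) (evec i + evec j).
  move=> i; have /fin_all_exists[w hw] := ex i.
  by exists (finfun w) => j; rewrite ffunE.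
by exists (\matrix_(i, j) om' i j) => i j; rewrite mxE.
Qed.
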